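(* There is a constant $C\ge 1$ such that for every separable Banach space $X$ satisfying $\mathrm{Sz}(X)>\omega$, we have $T_\infty\overset{C}{\hookrightarrow}X$ and $T_\infty\overset{C}{\hookrightarrow}X^*$.
   Context: Banach spaces are real. $\mathbb N$ is the set of positive integers and $\omega$ is the first infinite ordinal. Tree: $T_\infty=\bigcup_{i\ge0}\mathbb N^i$ (with $\mathbb N^0=\{\emptyset\}$) is the set of all finite sequences of positive integers. $|s|$ is the length of $s$; $s\le t$ means that $t$ extends $s$ ($s$ is an ancestor of $t$; $s\le s$). It is equipped with the hyperbolic distance $\rho(s,s')=|s|+|s'|-2|u|$, where $u$ is the greatest common ancestor (longest common initial segment) of $s$ and $s'$. Embeddings: for an injective map $f:(M,d)\to(N,\delta)$ between metric spaces, $\mathrm{dist}(f)=\sup_{x\ne y}\frac{\delta(f(x),f(y))}{d(x,y)}\cdot\sup_{x\ne y}\frac{d(x,y)}{\delta(f(x),f(y))}$. We write $M\overset{C}{\hookrightarrow}N$ if there is an injective $f:M\to N$ with $\mathrm{dist}(f)\le C$. Banach spaces carry the norm metric. Szlenk index: for a weak$^*$-compact $K\subset X^*$ and $\varepsilon>0$, $s_\varepsilon K=K\setminus\bigcup\{V: V\in\mathcal V\}$, where $\mathcal V$ is the set of relatively weak$^*$-open subsets $V$ of $K$ with norm diameter less than $\varepsilon$. Set $s^0_\varepsilon K=K$, $s_\varepsilon^{\alpha+1}K=s_\varepsilon(s_\varepsilon^\alpha K)$, and $s_\varepsilon^\alpha K=\bigcap_{\beta<\alpha}s_\varepsilon^\beta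 K$ for limit ordinals $\alpha$. $\mathrm{Sz}(X,\varepsilon)$ is the least ordinal $\alpha$ with $s_\varepsilon^\alpha B_{X^*}=\emptyset$ ($B_{X^*}$ the closed unit ball of $X^*$) if it exists, and $\mathrm{Sz}(X,\varepsilon)=\infty$ otherwise, where $\infty$ is larger than every ordinal. Finally $\mathrm{Sz}(X)=\sup_{\varepsilon>0}\mathrm{Sz}(X,\varepsilon)$. *)

(* Defs.v *)
From HB Require Import structures.
From mathcomp Require Import all_boot all_order all_algebra.
From mathcomp Require Import all_classical all_reals all_analysis.

Set Implicit Arguments.
Unset Strict Implicit.
Unset Printing Implicit Defensive.

Import Order.TTheory GRing.Theory Num.Theory.
Import numFieldNormedType.Exports.

Local Open Scope classical_set_scope.
Local Open Scope ring_scope.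

Definition separable (T : topologicalType) : Prop :=
  exists2 D : set T, countable D & dense D.

Section Dual.
Variables (R : realType) (X : normedModType R).

Definition is_functional : {pred X -> R^o} :=
  fun f => `[< linear f /\ continuous f >].

Record dual : Type := Dual {
  dual_fun :> X -> R^o;
  dual_funP : dual_fun \in is_functional }.

HB.instance Definition _ := [isSub for dual_fun].
HB.instance Definition _ := [Choice of dual by <:].

Lemma is_functional_submod : submod_closed is_functional.
Proof.
split=> [|a f g /asboolP[lf cf] /asboolP[lg cg]]; apply/asboolP; split.
- by move=> k u v; rewrite scaler0 addr0.
- exact: cst_continuous.
- move=> k u v; rewrite -[LHS]/(a *: f _ + g _) lf lg !scalerDr !scalerA.
  by rewrite (mulrC a k) addrACA -!scalerA -scalerDr.
- by move=> x; apply: cvgD; [apply: cvgZr; exact: cf | exact: cg].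
Qed.

HB.instance Definition _ :=
  GRing.isSubmodClosed.Build R (X -> R^o) is_functional is_functional_submod.
HB.instance Definition _ := [SubChoice_isSubLmodule of dual by <:].

Lemma dual_linear (f : dual) : linear (f : X -> R^o).
Proof. by have /asboolP[] := dual_funP f. Qed.

Lemma dual_continuous (f : dual) : continuous (f : X -> R^o).
Proof. by have /asboolP[] := dual_funP f. Qed.

HB.instance Definition _ (f : dual) :=
  GRing.isLinear.Build R X R^o _ (f : X -> R^o) (dual_linear f).

Lemma dual_funD (f g : dual) x : (f + g) x = f x + g x. Proof. by []. Qed.
Lemma dual_funN (f : dual) x : (- f) x = - f x. Proof. by []. Qed.
Lemma dual_funZ a (f : dual) x : (a *: f) x = a * f x. Proof. by []. Qed.

Definition dual_norm (f : dual) : R :=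
  sup [set `|f x| | x in [set x : X | `|x| <= 1]].

Lemma dual_norm_has_sup (f : dual) :
  has_sup [set `|f x| | x in [set x : X | `|x| <= 1]].
Proof.
split; first by exists `|f 0|, 0 => //=; rewrite normr0 ler01.
have /linear_boundedP : bounded_near f (nbhs (0 : X)).
  exact/continuous_linear_bounded/dual_continuous.
case/pinfty_ex_gt0 => r r0 fr; exists r => _ [x /= x1 <-].
by rewrite (le_trans (fr x))// ler_piMr// ltW.
Qed.

Lemma dual_norm_ub (f : dual) x : `|x| <= 1 -> `|f x| <= dual_norm f.
Proof.
by move=> x1; apply: ub_le_sup; [exact: (dual_norm_has_sup f).2 | exists x].
Qed.

Lemma dual_norm_lub (f : dual) c :
  (forall x, `|x| <= 1 -> `|f x| <= c) -> dual_norm f <= c.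
Proof.
move=> fc; apply: ge_sup; first exact: (dual_norm_has_sup f).1.
by move=> _ [x /= x1 <-]; exact: fc.
Qed.

Lemma dual_norm_ge0 (f : dual) : 0 <= dual_norm f.
Proof. by rewrite (le_trans _ (@dual_norm_ub f 0 _)) ?normr0. Qed.

Lemma dual_normD f g : dual_norm (f + g) <= dual_norm f + dual_norm g.
Proof.
apply: dual_norm_lub => x x1; rewrite dual_funD.
by rewrite (le_trans (ler_normD _ _))// lerD ?dual_norm_ub.
Qed.

Lemma dual_normZ a f : dual_norm (a *: f) = `|a| * dual_norm f.
Proof.
have le b g : dual_norm (b *: g) <= `|b| * dual_norm g.
  apply: dual_norm_lub => x x1.
  by rewrite dual_funZ normrM ler_wpM2l ?dual_norm_ub.
apply/eqP; rewrite eq_le le /=.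
have [->|a0] := eqVneq a 0; first by rewrite normr0 mul0r dual_norm_ge0.
have := le a^-1 (a *: f); rewrite scalerA mulVf// scale1r normfV.
by rewrite ler_pdivlMl ?normr_gt0.
Qed.

Lemma dual_norm0_eq0 f : dual_norm f = 0 -> f = 0.
Proof.
move=> f0; apply: val_inj; apply/funext => x /=.
have [->|x0] := eqVneq x 0; first by rewrite linear0.
have /(dual_norm_ub f) : `| `|x|^-1 *: x| <= 1.
  by rewrite normrZ normfV normr_id mulVf ?normr_eq0.
rewrite f0 normr_le0 linearZ /= scaler_eq0 invr_eq0 normr_eq0 (negPf x0) /=.
by move/eqP.
Qed.

HB.instance Definition _ :=
  Lmodule_isNormed.Build R dual dual_normD dual_normZ dual_norm0_eq0.

(* The coarsest topology on the dual that makes f |-> f x continuous for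
   every x in X; the topology of [dual] itself is that of the dual norm. *)
Definition weak_star : Type :=
  initial_topology (fun f : dual => (f : {ptws X -> R^o})).
HB.instance Definition _ := Topological.on weak_star.

Definition weak_star_open (U : set dual) : Prop := open (U : set weak_star).

Lemma weak_star_openP (U : set dual) : weak_star_open U <->
  exists2 A : set {ptws X -> R^o}, open A & dual_fun @^-1` A = U.
Proof. by []. Qed.

Definition dual_ball : set dual := [set f | `|f| <= 1].

End Dual.

(* Ordinal notations: [Osup A a] denotes the supremum of the ordinals denoted
   by the [a i], i : A, so that limits are suprema of families of smaller
   ordinals. Distinct terms may denote the same ordinal; equality of ordinals
   is [ord_le a b /\ ord_le b a]. *)
Inductive ord : Type :=
| Ozero
| Osucc of ord
| Osup (A : Type) of (A -> ord).

(* a + 1 <= b is a < b; and a < sup_i b_i iff a < b_i for some i. *)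
Fixpoint ord_le (a : ord) : ord -> Prop :=
  match a with
  | Ozero => fun=> True
  | Osucc a' => fix succ_le (b : ord) : Prop :=
      match b with
      | Ozero => False
      | Osucc b' => ord_le a' b'
      | Osup B b' => exists i : B, succ_le (b' i)
      end
  | Osup A a' => fun b => forall i : A, ord_le (a' i) b
  end.

Definition ord_lt (a b : ord) : Prop := ord_le (Osucc a) b.

Definition omega : ord := Osup (fun n : nat => iter n Osucc Ozero).

Lemma ord_le_sup (A : Type) (b : A -> ord) a i :
  ord_le a (b i) -> ord_le a (Osup b).
Proof.
elim: a => [//|a _|B a IH] /=; first by exists i.
by move=> H j; apply: IH.
Qed.

Lemma ord_ltW a b : ord_lt a b -> ord_le a b.
Proof.
rewrite /ord_lt; elim: a b => [//|a IH|A a IH] b.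
- by elim: b => [//|b _|B b IHb] /=; [exact: IH | case=> i /IHb; exists i].
- move=> H i; apply: (IH); elim: b H => [//|b _|B b IHb] /=; first exact.
  by case=> j /IHb; exists j.
Qed.

Lemma ord_le_refl a : ord_le a a.
Proof. by elim: a => [//|//|A a IH] /= i; apply: ord_le_sup (IH i). Qed.

Lemma ord_le_trans a b c : ord_le a b -> ord_le b c -> ord_le a c.
Proof.
elim: a b c => [//|a IH|A a IH] b c; last by move=> H bc i; apply: IH (H i) bc.
elim: b c => [//|b _|B b IHb] c; last first.
  by case=> i abi bc; apply: IHb abi (bc i).
move=> ab; elim: c => [//|c _|C c IHc] /=; first exact: IH.
by case=> i /IHc; exists i.
Qed.

Lemma ord_le_total a b : ord_le a b \/ ord_lt b a.
Proof.
rewrite /ord_lt; elim: a b => [|a IH|A a IH] b; first by left.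
- elim: b => [|b _|B b IHb] /=; first by right.
    exact: IH.
  have [[i abi]|H] := pselect (exists i, ord_lt a (b i)).
    by left; exists i.
  by right=> i; have [abi|//] := IHb i; case: H; exists i.
- have [[i abi]|H] := pselect (exists i, ord_lt b (a i)).
    by right; exists i.
  by left=> i; have [//|abi] := IH i b; case: H; exists i.
Qed.

Lemma ord_lt_irr a : ~ ord_lt a a.
Proof.
rewrite /ord_lt; elim: a => [//|//|A a IH] /= [i H]; apply: (IH i).
have : ord_lt (Osup a) (a i) by [].
by apply: ord_le_trans; rewrite /=; apply: ord_le_sup (ord_le_refl _).
Qed.

Lemma ord_lt_wf : well_founded ord_lt.
Proof.
suff H a : forall c, ord_lt c a -> Acc ord_lt c by move=> a; exact: Acc_intro (H a).
elim: a => [//|a IH|A a IH] c; last by case=> i; exact: IH.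
rewrite /ord_lt /= => ca; apply: Acc_intro => d dc; apply: IH.
exact: (@ord_le_trans (Osucc d) c a).
Qed.

(* Extended ordinals: [None] is the value oo, larger than every ordinal. *)
Definition xord := option ord.

Definition xord_lt (a b : xord) : Prop :=
  match a, b with
  | Some a, Some b => ord_lt a b
  | Some _, None => True
  | None, _ => False
  end.

Definition xord_sup (I : Type) (a : I -> xord) : xord :=
  if pselect (forall i, a i <> None)
  then Some (Osup (fun i => odflt Ozero (a i))) else None.

Definition ord_least (P : ord -> Prop) (a : ord) : Prop :=
  P a /\ forall b, P b -> ord_le a b.

(* The least ordinal satisfying P, and oo if there is none. *)
Definition xord_min (P : ord -> Prop) : xord :=
  if pselect (exists a, ord_least P a) is left e
  then Some (projT1 (cid e)) else None.

Lemma ord_least_ex (P : ord -> Prop) :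
  (exists a, P a) -> exists a, ord_least P a.
Proof.
case=> a; elim: a / (ord_lt_wf a) => a _ IH Pa.
have [[b [Pb ba]]|H] := pselect (exists b, P b /\ ord_lt b a).
  exact: IH ba Pb.
exists a; split=> // b Pb; have [//|ba] := ord_le_total a b.
by case: H; exists b.
Qed.

Section Szlenk.
Variables (R : realType) (X : normedModType R).
Implicit Types (K V : set (dual X)) (e : R).

(* The diameter of the empty set is -oo, which is harmless below. *)
Definition norm_diam V : \bar R :=
  ereal_sup [set (`|p.1 - p.2|)%:E | p in V `*` V].

Definition rel_weak_star_open K V : Prop :=
  exists2 U : set (dual X), weak_star_open U & V = U `&` K.

Definition szlenk_deriv e K : set (dual X) :=
  K `\` \bigcup_(V in [set V | rel_weak_star_open K V /\
                               (norm_diam V < e%:E)%E]) V.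

(* In the last clause, intersecting with K only matters for the empty family,
   whose supremum is 0. See [szlenk_iter_limit] for limit ordinals. *)
Fixpoint szlenk_iter e K (a : ord) : set (dual X) :=
  match a with
  | Ozero => K
  | Osucc a' => szlenk_deriv e (szlenk_iter e K a')
  | Osup A a' => K `&` \bigcap_(i in [set: A]) szlenk_iter e K (a' i)
  end.

Definition Sz_eps e : xord :=
  xord_min (fun a => szlenk_iter e (@dual_ball R X) a = set0).

Definition Sz : xord := xord_sup (fun e : {e : R | 0 < e} => Sz_eps (sval e)).

Lemma szlenk_deriv_mono e K V :
  K `<=` V -> szlenk_deriv e K `<=` szlenk_deriv e V.
Proof.
move=> KV f [Kf Hf]; split; first exact: KV.
case=> W [[U oU WE] dW] Wf; apply: Hf; exists (W `&` K) => //=; split.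
  exists U => //; rewrite WE -setIA; congr (_ `&` _).
  by rewrite setIC; apply/setIidPl.
apply: le_lt_trans dW; apply: ereal_sup_le => _ [p [[Wp1 _] [Wp2 _]] <-].
by exists p.
Qed.

Lemma szlenk_iter_sub e K a : szlenk_iter e K a `<=` K.
Proof. by elim: a => [//|a IH|A a IH] f /= [] // /IH. Qed.

Lemma szlenk_iter_antitone e K a b :
  ord_le a b -> szlenk_iter e K b `<=` szlenk_iter e K a.
Proof.
elim: a b => [|a IH|A a IH] b; first by move=> _; exact: szlenk_iter_sub.
- elim: b => [//|b _ /= ab|B b IHb /= [i abi] f [_ Hf]].
    exact/szlenk_deriv_mono/IH.
  exact: IHb abi _ (Hf i I).
- move=> ab f Hf; split; first exact: szlenk_iter_sub Hf.
  by move=> i _; apply: IH (ab i) _ Hf.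
Qed.

Lemma szlenk_iter_limit e K a : ord_lt Ozero a ->
  (forall b, ord_lt b a -> ord_lt (Osucc b) a) ->
  szlenk_iter e K a = \bigcap_(b in [set b | ord_lt b a]) szlenk_iter e K b.
Proof.
move=> a0 aS; apply/seteqP; split=> f Hf.
  by move=> b /= ba; apply: (szlenk_iter_antitone (ord_ltW ba)).
elim: a a0 aS Hf => [//|a _ _ aS|A a IH a0 aS Hf].
  by case: (@ord_lt_irr (Osucc a)); apply: aS; exact: ord_le_refl.
split=> [|i _]; first exact: szlenk_iter_sub (Hf Ozero _).
have ltsup b : ord_lt b (a i) -> ord_lt b (Osup a) by exists i.
have [ai|ai] := ord_le_total (Osup a) (a i); last exact: Hf.
apply: IH.
- exact: ord_le_trans ai.
- by move=> b /ltsup /aS; rewrite /ord_lt => /ord_le_trans; exact.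
- by move=> b /= /ltsup; exact: Hf.
Qed.

End Szlenk.

Section Embeddings.
Variables (R : realType) (M N : Type).
Variables (dM : M -> M -> R) (dN : N -> N -> R).

Definition distortion (f : M -> N) : \bar R :=
  (ereal_sup [set (dN (f p.1) (f p.2) / dM p.1 p.2)%:E
             | p in [set p | p.1 <> p.2]] *
   ereal_sup [set (dM p.1 p.2 / dN (f p.1) (f p.2))%:E
             | p in [set p | p.1 <> p.2]])%E.

Definition embeds (C : R) : Prop :=
  exists2 f : M -> N, injective f & (distortion f <= C%:E)%E.

End Embeddings.

Definition norm_dist (R : realType) (V : normedModType R) (x y : V) : R :=
  `|x - y|.

Definition tree : Type := seq {n : nat | (0 < n)%N}.

Fixpoint common_ancestor (s t : tree) : tree :=
  match s, t with
  | x :: s', y :: t' => if x == y then x :: common_ancestor s' t' else [::]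
  | _, _ => [::]
  end.

Definition tree_dist (R : realType) (s t : tree) : R :=
  (size s)%:R + (size t)%:R - 2 * (size (common_ancestor s t))%:R.

Lemma common_ancestor_greatest (s t u : tree) :
  prefix u (common_ancestor s t) = prefix u s && prefix u t.
Proof.
elim: s t u => [|x s IH] [|y t] [|z u] //=; rewrite ?andbF ?prefix0s //.
have [<-|xy] /= := eqVneq x y; first by rewrite IH; case: (z == x).
by have [->|] //= := eqVneq z x; rewrite (negPf xy) andbF.
Qed.

(* Main.v *)
From HB Require Import structures.
Require Import Defs.
From mathcomp Require Import all_boot all_order all_algebra.
From mathcomp Require Import all_classical all_reals all_analysis.
From mathcomp Require Import ring lra.

Set Implicit Arguments.
Unset Strict Implicit.
Unset Printing Implicit Defensive.

Import Order.TTheory GRing.Theory Num.Theory.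
Import numFieldNormedType.Exports.

Local Open Scope classical_set_scope.
Local Open Scope ring_scope.

(** Fix [a = 1/2] and write [B] for the dual unit ball and [D] for the
    Szlenk derivation of parameter [1/2].

    _Reduction to the parameter 1/2._ Suppose that [D^m B] is empty for some
    [m]. Since the derivations are local and commute with affine maps, [m]
    derivations of parameter [a e] do to a weak-star open piece of diameter
    less than [e] at least what [m] derivations of parameter [a] do to the
    unit ball: they remove it. Iterating at the scales [a^k], the derivation
    of parameter [a^k] empties [B] in [m^k] steps ([iter_szlenk_deriv_exp]),
    so that all the indices are finite and their supremum is at most
    [omega]. Hence [D^N B] is nonempty for every [N] ([Sz_gt_omega_iter]),
    and the constant of the theorem does not depend on [X].

    _Trees in the dual._ A point [z] of [D K] is a weak-star limit of points
    [z'] of [K] at norm distance at least [1/5] from it. Starting from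
    points of [D^N B], one obtains for every [N] a tree of height [N] of
    elements of [B], indexed by sequences, whose increments [y_t] are
    bounded below in norm and can be taken arbitrarily small on any finite
    set of vectors. A vector on which an increment is large and finitely
    many given functionals are small is found as a half-difference [(x_j -
    x_i) / 2] of norming vectors, by the pigeonhole principle
    ([szlenk_deriv_step]); two small corrections then make the system
    exactly biorthogonal ([biorthogonal_extend]). All these trees, for all
    [N], are constructed together by one recursion along an enumeration of
    their nodes in which parents come first ([biorthogonal_forest]). The
    vectors [x_(n,t)] of the system, and the sums [Z_(n,t)] of its
    functionals along the branches, are bounded, for [t] of length at most
    [2^(n+1)], and [Z_(n,t) (x_(m,t'))] is equal to [1] if [n = m] and [t']
    is an initial segment of [t], and to [0] otherwise, for [t'] nonempty
    ([Sz_tree_system]).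

    _Embedding of the infinite tree._ Let [v] be either of the families [x]
    and [Z], and let [f_n(t)] be the sum of [v_(n,t')] over the nonempty
    initial segments [t'] of [t]. For [2^n <= |t| <= 2^(n+1)], the point [t]
    is sent to the convex combination of [f_n(t)] and [f_(n+1)(t)] whose
    weights are affine in [|t|]. This map is Lipschitz, because the weights
    vary by [2^-n] while [f_n] is of size [2^n]. If [u] is the greatest
    common ancestor of [s] and [s'], some functional of bounded norm takes
    the value [|s| - |u|] at the image of [s] and [0] at the image of [s']
    ([shell_sum_separated]): for [v = x] it is a sum of two differences
    [Z_(m,s) - Z_(m,u)], and for [v = Z] it is the evaluation at a sum of
    two vectors [x_(m,w)], where [w] is the child of [u] below [s]. *)

(** * The weak-star topology *)

Section WeakStar.
Variables (R : realType) (X : normedModType R).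
Implicit Types (f g : dual X) (x : X) (K V U : set (dual X)).

Lemma weak_star_eval_continuous x :
  continuous ((fun f : weak_star X => (f : dual X) x) : weak_star X -> R^o).
Proof.
have ci := @initial_continuous _ _ (fun f : dual X => (f : {ptws X -> R^o})).
move=> f.
exact: (@continuous_comp _ _ _ _ _ f (ci f)
  (@proj_continuous X (fun=> R^o) x (f : dual X))).
Qed.

Lemma weak_star_open_slab f x (d : R) :
  weak_star_open [set g : dual X | `|(g - f) x| < d].
Proof.
have -> : [set g : dual X | `|(g - f) x| < d] =
    (fun g : weak_star X => (g : dual X) x) @^-1` [set r : R^o | `|r - f x| < d].
  by apply/seteqP; split=> g.
apply: open_comp => [g _|]; first exact: weak_star_eval_continuous.
have -> : [set r : R^o | `|r - f x| < d] = ball (f x : R^o) d.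
  by apply/seteqP; split=> r /=; rewrite /ball /= distrC.
exact: ball_open.
Qed.

Lemma weak_star_openT : weak_star_open [set: dual X].
Proof. exact: openT. Qed.

Lemma weak_star_openI U V :
  weak_star_open U -> weak_star_open V -> weak_star_open (U `&` V).
Proof. exact: openI. Qed.

Lemma weak_star_open_nbhd f (s : seq X) (d : R) :
  weak_star_open [set g : dual X | forall x, x \in s -> `|(g - f) x| < d].
Proof.
elim: s => [|x s IH].
  rewrite (_ : [set _ | _] = setT); first exact: weak_star_openT.
  by apply/seteqP; split.
rewrite (_ : [set _ | _] = [set g : dual X | `|(g - f) x| < d] `&`
  [set g : dual X | forall y, y \in s -> `|(g - f) y| < d]).
  exact: weak_star_openI (weak_star_open_slab _ _ _) IH.
apply/seteqP; split=> g /=.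
  by move=> H; split=> [|y ys]; apply: H; rewrite inE ?eqxx// ys orbT.
by case=> H1 H2 y; rewrite inE => /predU1P[->|/H2].
Qed.

(** Affine maps [g |-> a *: (g - f)] are weak-star continuous. *)
Lemma weak_star_open_affine (a : R) f U : weak_star_open U ->
  weak_star_open [set g : dual X | U (a *: (g - f))].
Proof.
move=> oU; pose h (g : weak_star X) : weak_star X := a *: ((g : dual X) - f).
rewrite (_ : [set _ | _] = h @^-1` U)//.
apply: open_comp oU => g _.
apply: (@continuous_comp_initial _ _ _ (fun f : dual X => (f : {ptws X -> R^o})) h).
move=> {}g; apply/cvg_sup; first exact/fmap_filter/(nbhs_filter (g : weak_star X)).
move=> x; apply/cvg_image; first exact/fmap_filter/(nbhs_filter (g : weak_star X)).
  by apply/seteqP; split=> // r _; exists (fun=> r).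
have ck : continuous (fun r : R^o => a *: (r - f x) : R^o).
  by move=> r; apply: cvgZl_tmp; apply: cvgB; [exact: cvg_id | exact: cvg_cst].
have cx := @weak_star_eval_continuous x.
have chx := @continuous_comp _ _ _ _ _ g (cx g) (ck _).
rewrite /h => A /= nA.
exists ((fun u : X -> R^o => u x) @^-1` A); last first.
  by apply/seteqP; split=> [r [u Au <-]//|r Ar]; exists (fun=> r).
exact: chx.
Qed.

End WeakStar.

(** * Finite Szlenk derivations at different scales *)

Section SzlenkIteration.
Variables (R : realType) (X : normedModType R).
Implicit Types (f g : dual X) (e a : R) (K U V : set (dual X)).

Lemma szlenk_iter_nat e K n :
  szlenk_iter e K (iter n Osucc Ozero) = iter n (szlenk_deriv e) K.
Proof. by elim: n => //= n ->. Qed.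

Lemma szlenk_deriv_le e e' K :
  e' <= e -> szlenk_deriv e K `<=` szlenk_deriv e' K.
Proof.
move=> ee' f [Kf H]; split=> // -[V [oV dV] Vf]; apply: H; exists V => //.
by split=> //; rewrite (lt_le_trans dV)// lee_fin.
Qed.

Lemma iter_szlenk_deriv_mono e e' K V n : e' <= e -> K `<=` V ->
  iter n (szlenk_deriv e) K `<=` iter n (szlenk_deriv e') V.
Proof.
move=> ee' KV; elim: n => //= n IH; apply: subset_trans (szlenk_deriv_le ee').
exact: szlenk_deriv_mono.
Qed.

Lemma iter_szlenk_deriv_sub e K n : iter n (szlenk_deriv e) K `<=` K.
Proof. by elim: n => //= n IH f [/IH]. Qed.

(** A weak-star open set [U] does not see what happens outside of it. *)
Lemma szlenk_deriv_local e K U :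
  weak_star_open U -> szlenk_deriv e K `&` U `<=` szlenk_deriv e (K `&` U).
Proof.
move=> oU f [[Kf H] Uf]; split=> // -[_ [[W oW ->] dW] [Wf _]]; apply: H.
exists (W `&` (K `&` U)) => //; split=> //; exists (W `&` U).
  exact: weak_star_openI.
by rewrite -setIA (setIC U).
Qed.

Lemma iter_szlenk_deriv_local e K U n : weak_star_open U ->
  iter n (szlenk_deriv e) K `&` U `<=` iter n (szlenk_deriv e) (K `&` U).
Proof.
move=> oU; elim: n => //= n IH.
by move=> f /(szlenk_deriv_local oU); exact: szlenk_deriv_mono.
Qed.

Lemma norm_diam_le V e :
  (forall f g, V f -> V g -> `|f - g| <= e) -> (norm_diam V <= e%:E)%E.
Proof.
move=> H; apply: ge_ereal_sup => _ [[f g] [/= Vf Vg] <-].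
by rewrite lee_fin H.
Qed.

Lemma norm_diam_lt V e f g :
  (norm_diam V < e%:E)%E -> V f -> V g -> `|f - g| < e.
Proof.
move=> dV Vf Vg; rewrite -lte_fin; apply: le_lt_trans dV.
by apply: ereal_sup_ubound; exists (f, g).
Qed.

(** The derivation commutes with the affine maps [g |-> f + a *: g], up to
    scaling of the diameters. *)
Lemma szlenk_deriv_affine a e f K : 0 < a ->
  szlenk_deriv (e * a) [set g | K (a^-1 *: (g - f))] `<=`
  [set g | szlenk_deriv e K (a^-1 *: (g - f))].
Proof.
move=> a0 g [Kg H]; split=> // -[_ [[W oW ->] dW] [Wg _]]; apply: H.
exists ([set h | W (a^-1 *: (h - f))] `&` [set h | K (a^-1 *: (h - f))]) => //.
split; first by exists [set h | W (a^-1 *: (h - f))] => //;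
  exact: weak_star_open_affine.
have an0 : a != 0 by rewrite gt_eqF.
(* the strict inequality on the diameter is a strict bound by a real number,
   which survives the passage to the supremum *)
have [r dr re] : exists2 r : R, (norm_diam (W `&` K) <= r%:E)%E & r < e.
  move: dW; case: (norm_diam (W `&` K)) => [r|//|].
    by rewrite lte_fin => re; exists r.
  by move=> _; exists (e - 1); rewrite ?leNye// ltrBlDr ltrDl.
apply: (@le_lt_trans _ _ (r * a)%:E); last by rewrite lte_fin ltr_pM2r.
apply: norm_diam_le => h k [Wh Kh] [Wk Kk].
rewrite -ler_pdivrMr// mulrC -{1}(gtr0_norm a0) -normfV -normrZ.
have -> : a^-1 *: (h - k) = a^-1 *: (h - f) - a^-1 *: (k - f).
  by rewrite -scalerBr opprB addrA subrK.
rewrite -lee_fin; apply: le_trans dr; apply: ereal_sup_ubound.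
by exists (a^-1 *: (h - f), a^-1 *: (k - f)).
Qed.

Lemma iter_szlenk_deriv_affine a e f K n : 0 < a ->
  iter n (szlenk_deriv (e * a)) [set g | K (a^-1 *: (g - f))] `<=`
  [set g | iter n (szlenk_deriv e) K (a^-1 *: (g - f))].
Proof.
move=> a0; elim: n => //= n IH.
by move=> g /(szlenk_deriv_mono IH) /(szlenk_deriv_affine a0).
Qed.

(** A piece of [K] of diameter less than [a] lies in a ball of radius [a], so
    the [e * a]-derivations exhaust it as fast as the [e]-derivations exhaust
    the unit ball. *)
Lemma iter_szlenk_deriv_absorb a e K m : 0 < a ->
  iter m (szlenk_deriv e) (@dual_ball R X) = set0 ->
  iter m (szlenk_deriv (e * a)) K `<=` szlenk_deriv a K.
Proof.
move=> a0 m0 f Hf; split; first exact: iter_szlenk_deriv_sub Hf.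
case=> _ [[U oU ->] dU] [Uf Kf].
have := @iter_szlenk_deriv_local (e * a) K U m oU f (conj Hf Uf).
have KU : K `&` U `<=` [set g | @dual_ball R X (a^-1 *: (g - f))].
  move=> g [Kg Ug]; rewrite /dual_ball /= normrZ normfV (gtr0_norm a0).
  by rewrite ler_pdivrMl// mulr1 ltW// (norm_diam_lt dU).
move/(iter_szlenk_deriv_mono (lexx _) KU)/(iter_szlenk_deriv_affine a0) => /=.
by rewrite m0.
Qed.

(** The inequality [Sz(X, e a) <= Sz(X, e) Sz(X, a)], for finite indices. *)
Lemma iter_szlenk_deriv_mul a e K m j : 0 < a ->
  iter m (szlenk_deriv e) (@dual_ball R X) = set0 ->
  iter (j * m) (szlenk_deriv (e * a)) K `<=` iter j (szlenk_deriv a) K.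
Proof.
move=> a0 m0; elim: j => [//|j IH]; rewrite mulSn iterD iterS.
by move=> f /(iter_szlenk_deriv_absorb a0 m0) /(szlenk_deriv_mono IH).
Qed.

Lemma iter_szlenk_deriv_exp a m k : 0 < a ->
  iter m (szlenk_deriv a) (@dual_ball R X) = set0 ->
  iter (m ^ k.+1)%N (szlenk_deriv (a ^+ k.+1)) (@dual_ball R X) = set0.
Proof.
move=> a0 m0; elim: k => [|k IH]; first by rewrite expn1 expr1.
rewrite expnSr exprS; apply/seteqP; split=> // f.
by move/(iter_szlenk_deriv_mul (exprn_gt0 _ a0) m0); rewrite IH.
Qed.

Lemma Sz_gt_omega_ex : xord_lt (Some omega) (Sz X) ->
  exists2 e : R, 0 < e &
    forall n, iter n (szlenk_deriv e) (@dual_ball R X) !=set0.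
Proof.
move=> H; apply: contrapT => N.
have {}N (e : {e : R | 0 < e}) :
    exists a : ord, Sz_eps X (sval e) = Some a /\ ord_le a omega.
  have [n n0] : exists n,
      iter n (szlenk_deriv (sval e)) (@dual_ball R X) = set0.
    apply: contrapT => E; apply: N; exists (sval e); first exact: (svalP e).
    move=> n; apply/set0P/eqP => E'; by apply: E; exists n.
  rewrite -szlenk_iter_nat in n0.
  rewrite /Sz_eps /xord_min; case: pselect => [ex|nex]; last first.
    by case: nex; apply: ord_least_ex; eexists; exact: n0.
  exists (projT1 (cid ex)); split=> //.
  have [_ /(_ _ n0) le] := projT2 (cid ex); apply: (ord_le_trans le).
  by apply: ord_le_sup (ord_le_refl _).
move: H; rewrite /Sz /xord_sup; case: pselect => [ex|nex]; last first.
  by case: nex => e; have [a [-> _]] := N e.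
case=> e; have [a [-> ao]] := N e => /= oa.
by apply: (@ord_lt_irr omega); apply: (ord_le_trans _ ao).
Qed.

Lemma Sz_gt_omega_iter a : xord_lt (Some omega) (Sz X) ->
  0 < a -> a < 1 ->
  forall n, iter n (szlenk_deriv a) (@dual_ball R X) !=set0.
Proof.
move=> /Sz_gt_omega_ex[e e0 He] a0 a1 m; apply/set0P/eqP => m0.
have [k ke] : exists k, a ^+ k.+1 <= e.
  have /cvgrPdist_lt /(_ e e0) : (a ^+ n @[n --> \oo] --> (0 : R)).
    by apply: cvg_expr; rewrite ger0_norm// ltW.
  case=> k _ /(_ k.+1 (leqnSn k)) /=.
  rewrite sub0r normrN ger0_norm ?exprn_ge0 ?ltW// => /ltW ke.
  by exists k.
have [f] := He (m ^ k.+1)%N.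
move/(@iter_szlenk_deriv_mono _ _ _ _ (m ^ k.+1)%N ke (@subset_refl _ _)).
by rewrite iter_szlenk_deriv_exp.
Qed.

End SzlenkIteration.

(** * Two combinatorial tools *)

(** Recursive choice of a sequence whose [k]-th term must satisfy a condition
    [Q k h] that depends on the terms [h j], [j < k], already chosen. *)
Lemma strong_choice (S : Type) (s0 : S) (Q : nat -> (nat -> S) -> S -> Prop) :
  (forall k h h' s, (forall j, (j < k)%N -> h j = h' j) ->
    Q k h s -> Q k h' s) ->
  (forall k h, (forall j, (j < k)%N -> Q j h (h j)) -> exists s, Q k h s) ->
  exists h, forall k, Q k h (h k).
Proof.
move=> Qext Qex.
pose next k h := if pselect (exists s, Q k h s) is left e
  then projT1 (cid e) else s0.
have nextP k h : (exists s, Q k h s) -> Q k h (next k h).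
  by rewrite /next; case: pselect => // e _; exact: (projT2 (cid e)).
pose H := fix H k : nat -> S := if k is k'.+1
  then fun j => if j == k' then next k' (H k') else H k' j else fun=> s0.
have HE m j : (j < m)%N -> H m j = H j.+1 j.
  elim: m => [//|m IH]; rewrite ltnS leq_eqVlt => /predU1P[->//|jm].
  by rewrite -IH//= ltn_eqF.
pose h j := H j.+1 j; exists h.
have hE k : h k = next k (H k) by rewrite /h /= eqxx.
move=> k; elim/ltn_ind: k => k IH.
apply: (Qext k (H k)) => [j jk|]; first exact: HE.
rewrite hE; apply: nextP.
have [s Qs] := Qex k h IH.
by exists s; apply: Qext Qs => j jk; rewrite HE.
Qed.

(** Among infinitely many points of a box of dimension [k], two are close. *)
Lemma bounded_pigeonhole (R : realType) (k : nat) (r : nat -> nat -> R)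
    (M d : R) :
  0 < d -> (forall w i, (w < k)%N -> `|r w i| <= M) ->
  exists i j, (i < j)%N /\ forall w, (w < k)%N -> `|r w j - r w i| <= d.
Proof.
move=> d0 rM.
(* [t w i] numbers the interval of length [d] that contains [r w i] *)
pose t w i := Num.truncn ((r w i + M) / d).
pose N := Num.truncn ((M + M) / d).
have tN w i : (w < k)%N -> (t w i < N.+1)%N.
  move=> wk; have := rM w i wk; rewrite ltnS ler_norml => /andP[_ le].
  by apply: Num.Theory.le_truncn; rewrite ler_pM2r ?invr_gt0// lerD2r.
pose col (i : nat) := [ffun w : 'I_k => inord (t w i) : 'I_N.+1].
have : ~~ injectiveb (fun i : 'I_(#|{ffun 'I_k -> 'I_N.+1}|.+1) => col i).
  apply/negP => /injectiveP/leq_card; by rewrite card_ord ltnn.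
case/injectivePn => i0 [j0 ij cij].
have close (i j w : nat) : (w < k)%N -> t w i = t w j -> `|r w j - r w i| <= d.
  move=> wk tij.
  have nn u : 0 <= (r w u + M) / d.
    rewrite divr_ge0 ?(ltW d0)//; have := rM w u wk.
    by rewrite ler_norml -lerBlDr sub0r => /andP[].
  have /andP[a1 a2] := Num.Theory.truncn_itv (nn i).
  have /andP[b1 b2] := Num.Theory.truncn_itv (nn j).
  move: a1 a2 b1 b2; rewrite -/(t w i) -/(t w j) tij -natr1.
  rewrite !ler_pdivlMr// !ltr_pdivrMr// mulrDl mul1r => a1 a2 b1 b2.
  by rewrite ler_norml; apply/andP; split; lra.
have tE w : (w < k)%N -> t w i0 = t w j0.
  move=> wk; have := congr1 (fun f : {ffun 'I_k -> 'I_N.+1} =>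
    nat_of_ord (f (Ordinal wk))) cij.
  by rewrite !ffunE /= !inordK ?tN.
have [ltij|ltji|eij] := ltngtP i0 j0.
- by exists i0, j0; split=> // w wk; apply: close; rewrite ?tE.
- by exists j0, i0; split=> // w wk; apply: close; rewrite ?tE.
- by case/eqP: ij; apply/val_inj.
Qed.

(** * Biorthogonal systems along a forest *)

Section BiorthogonalForest.
Variables (R : realType) (X : normedModType R).
Implicit Types (f g z y : dual X) (x : X) (c d e : R) (K U : set (dual X)).

Lemma dual_norm_le f x : `|f x| <= `|f| * `|x|.
Proof.
have [->|x0] := eqVneq x 0; first by rewrite linear0 !normr0 mulr0.
have /(dual_norm_ub f) : `| `|x|^-1 *: x| <= 1.
  by rewrite normrZ normfV normr_id mulVf ?normr_eq0.
rewrite linearZ /= normrZ normfV normr_id mulrC ler_pdivrMr ?normr_gt0//.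
Qed.

Lemma dual_fun_sum (I : Type) (r : seq I) (P : pred I) (F : I -> dual X) x :
  (\sum_(i <- r | P i) F i : dual X) x = \sum_(i <- r | P i) F i x.
Proof. exact: (big_morph (fun f : dual X => f x)). Qed.

(** Every weak-star neighbourhood of [z] in [K] has diameter at least [e], so
    it contains a point at distance at least [c] of [z]. *)
Lemma szlenk_deriv_far e c K U z : 2 * c < e -> weak_star_open U ->
  szlenk_deriv e K z -> U z ->
  exists z' x, [/\ K z', U z', `|x| <= 1 & c <= (z' - z) x].
Proof.
move=> ce oU [Kz H] Uz; apply: contrapT => N; apply: H.
exists (U `&` K) => //; split; first by exists U.
apply: (@le_lt_trans _ _ (2 * c)%:E); last by rewrite lte_fin.
have B f : U f -> K f -> `|f - z| <= c.
  move=> Uf Kf; apply: dual_norm_lub => x x1.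
  have lt x' : `|x'| <= 1 -> (f - z) x' < c.
    move=> x'1; rewrite ltNge; apply/negP => ?; apply: N.
    by exists f, x'.
  have := lt x x1; have := lt (- x); rewrite normrN linearN => /(_ x1) h1 h2.
  by rewrite ler_norml; apply/andP; split; lra.
apply: norm_diam_le => f g [Uf Kf] [Ug Kg].
rewrite -(subrK z f) -addrA (le_trans (ler_normD _ _))//.
by rewrite mulr_natl mulr2n lerD ?B// distrC B.
Qed.

(** The pair [(z', x)] is almost orthogonal to the vectors of [s] and to the
    functionals [ys i], [i < k]. *)
Lemma szlenk_deriv_step e c d K z k (s : seq X) (ys : nat -> dual X) :
  0 < c -> 2 * c < e -> 0 < d -> szlenk_deriv e K z ->
  exists z' x, [/\ K z', `|x| <= 1, c / 4 <= (z' - z) x,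
    forall w, w \in s -> `|(z' - z) w| <= d &
    forall i, (i < k)%N -> `|ys i x| <= d].
Proof.
move=> c0 ce d0 Kz.
pose Q i (h : nat -> dual X * X) (p : dual X * X) :=
  [/\ K p.1, `|p.2| <= 1, c <= (p.1 - z) p.2,
    forall w, w \in s -> `|(p.1 - z) w| <= d &
    forall j, (j < i)%N -> `|(p.1 - z) (h j).2| <= c / 2].
have [h hQ] : exists h, forall i, Q i h (h i).
  apply: (strong_choice (0, 0)).
    by move=> k' h h' p E [? ? ? ? H]; split=> // j jk; rewrite -E// H.
  move=> i h _.
  pose U1 := [set g : dual X | forall x, x \in s -> `|(g - z) x| < d].
  pose U2 := [set g : dual X |
    forall x, x \in [seq (h j).2 | j <- iota 0 i] -> `|(g - z) x| < c / 2].
  have oU : weak_star_open (U1 `&` U2).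
    by apply: weak_star_openI; exact: weak_star_open_nbhd.
  have Uz : (U1 `&` U2) z.
    by split=> x _; rewrite subrr /= normr0// divr_gt0.
  have [z' [x [Kz' [U1z' U2z'] x1 cx]]] := szlenk_deriv_far ce oU Kz Uz.
  exists (z', x); split=> //= [w /U1z'/ltW//|j ji].
  by apply/ltW/U2z'/mapP; exists j => //; rewrite mem_iota.
(* two of the vectors [(h i).2] are almost identified by the [ys w], and the
   functional attached to the later one is small on the earlier one *)
have ysM w i : (w < k)%N -> `|ys w (h i).2| <= \sum_(w < k) `|ys w|.
  move=> wk; have [_ x1 _ _ _] := hQ i.
  apply: (le_trans (dual_norm_le _ _)).
  apply: (@le_trans _ _ (`|ys w| * 1)); first by rewrite ler_wpM2l.
  by rewrite mulr1 (bigD1 (Ordinal wk))//= lerDl sumr_ge0.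
have [i [j [ij H]]] := bounded_pigeonhole d0 ysM.
have [Kj xj cj sj /(_ i ij) hij] := hQ j; have [_ xi _ _ _] := hQ i.
exists (h j).1, (2^-1 *: ((h j).2 - (h i).2)); split=> //.
- rewrite normrZ normfV ger0_norm// ler_pdivrMl// mulr1.
  by rewrite (le_trans (ler_normB _ _))// -[2]/(1 + 1) lerD.
- move: cj hij; set f := _ - z => cj; rewrite ler_norml => /andP[_ hij].
  by rewrite linearZ linearB; change (c / 4 <= 2^-1 * (f (h j).2 - f (h i).2)); lra.
- move=> w /H; rewrite linearZ /= linearB /= normrM normfV => le.
  rewrite [`|2|]ger0_norm// ler_pdivrMl// (le_trans le)//.
  by rewrite ler_peMl ?ler1n// ltW.
Qed.

(** Subtracting from the almost orthogonal pair its components along the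
    system makes it exactly biorthogonal to the system. The vector can be
    rescaled, since the functional keeps a value at least [c / 8] on it. *)
Lemma biorthogonal_extend e c d K z k (good : pred nat)
    (x : nat -> X) (y : nat -> dual X) :
  0 < c -> 2 * c < e -> 0 < d -> szlenk_deriv e K z ->
  (forall i j, (i < k)%N -> (j < k)%N -> good i -> good j ->
    y i (x j) = (i == j)%:R) ->
  exists z' y' x', [/\ K z', `|x'| <= 16 / c, `|y' - (z' - z)| <= d,
    y' x' = 1 & forall j, (j < k)%N -> good j -> y' (x j) = 0 /\ y j x' = 0].
Proof.
move=> c0 ce d0 Kz biorth.
(* [del] is so small that both corrections have norm at most [b] *)
pose M := \sum_(j < k) (`|x j| + `|y j|).
have M0 : 0 <= M by apply: sumr_ge0 => j _; rewrite addr_ge0.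
pose b := Num.min 1 (Num.min d (c / 8)).
have b0 : 0 < b by rewrite /b !lt_min ltr01 d0 divr_gt0.
pose del := b / (M + 1).
have del0 : 0 < del by rewrite divr_gt0// ltr_wpDl.
have delM : del * M <= b.
  by rewrite /del mulrAC ler_pdivrMr ?ltr_wpDl// ler_wpM2l ?(ltW b0)// lerDl.
have [z' [x0 [Kz' x01 cx0 Hx Hy]]] := @szlenk_deriv_step e c del K z k
  [seq x j | j <- iota 0 k] y c0 ce del0 Kz.
have {}Hx j : (j < k)%N -> `|(z' - z) (x j)| <= del.
  by move=> jk; apply: Hx; apply/mapP; exists j => //; rewrite mem_iota.
pose y0 := z' - z.
pose y1 : dual X := y0 - \sum_(j < k | good j) y0 (x j) *: y j.
pose x1 := x0 - \sum_(j < k | good j) y j x0 *: x j.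
have sumM (F : nat -> R) : (forall j, (j < k)%N -> F j <= `|x j| + `|y j|) ->
    del * (\sum_(j < k | good j) F j) <= b.
  move=> FM; apply: le_trans delM; rewrite ler_wpM2l ?(ltW del0)//.
  rewrite /M big_mkcond /=; apply: ler_sum => j _; case: ifP => _; last first.
    by rewrite addr_ge0.
  exact: FM.
have y1y0 : `|y1 - y0| <= b.
  rewrite /y1 addrC addKr normrN (le_trans (ler_norm_sum _ _ _))//.
  apply: le_trans (sumM (fun j => `|y j|) _); last first.
    by move=> j _; rewrite lerDr.
  by rewrite mulr_sumr; apply: ler_sum => j _; rewrite normrZ ler_wpM2r ?Hx.
have x1le : `|x1| <= 2.
  rewrite /x1 -[2]/(1 + 1) (le_trans (ler_normB _ _))// lerD//.
  apply: (@le_trans _ _ b); last by rewrite /b ge_min lexx.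
  rewrite (le_trans (ler_norm_sum _ _ _))//.
  apply: le_trans (sumM (fun j => `|x j|) _); last first.
    by move=> j _; rewrite lerDl.
  by rewrite mulr_sumr; apply: ler_sum => j _; rewrite normrZ ler_wpM2r ?Hy.
have y1x j : (j < k)%N -> good j -> y1 (x j) = 0.
  move=> jk gj; rewrite /y1 dual_funD dual_funN dual_fun_sum.
  under eq_bigr do rewrite dual_funZ.
  rewrite (bigD1 (Ordinal jk))//= biorth// eqxx mulr1.
  rewrite big1 ?addr0 ?subrr// => i /andP[gi ij].
  rewrite biorth// (_ : (_ == _) = false) ?mulr0//.
  by apply/negbTE; apply: contraNneq ij => E; apply/eqP/val_inj.
clearbody y1.
have yx1 j : (j < k)%N -> good j -> y j x1 = 0.
  move=> jk gj; rewrite /x1 linearB /= linear_sum /=.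
  rewrite (bigD1 (Ordinal jk))//= linearZ /= biorth// eqxx /= [_ *: _]mulr1.
  rewrite big1 ?addr0 ?subrr// => i /andP[gi ij].
  rewrite linearZ /= biorth// (_ : (_ == _) = false) ?[_ *: _]mulr0//.
  by apply/negbTE; apply: contraNneq ij => E; apply/eqP/val_inj.
have y1x1 : c / 8 <= y1 x1.
  have -> : y1 x1 = y1 x0.
    rewrite /x1 [LHS]linearB; apply/eqP; rewrite subr_eq addrC -subr_eq subrr.
    rewrite eq_sym; apply/eqP; rewrite linear_sum big1// => j gj.
    by rewrite linearZ /= y1x// [_ *: _]mulr0.
  have := dual_norm_le (y1 - y0) x0; rewrite dual_funD dual_funN => le.
  have {le} : `|y1 x0 - y0 x0| <= c / 8.
    apply: (le_trans le); apply: (@le_trans _ _ (`|y1 - y0| * 1)).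
      by rewrite ler_wpM2l.
    by rewrite mulr1 (le_trans y1y0)// /b !ge_min lexx !orbT.
  by rewrite ler_norml => /andP[]; rewrite -/y0 in cx0; lra.
have y1x1_gt0 : 0 < y1 x1 by apply: lt_le_trans y1x1; rewrite divr_gt0.
exists z', y1, ((y1 x1)^-1 *: x1); split=> //.
- rewrite normrZ normfV (gtr0_norm y1x1_gt0) ler_pdivrMl//.
  apply: (le_trans x1le); apply: (@le_trans _ _ (c / 8 * (16 / c))).
    by rewrite le_eqVlt; apply/orP; left; apply/eqP; field; rewrite gt_eqF.
  by rewrite ler_wpM2r// divr_ge0// ltW.
- by rewrite (le_trans y1y0)// /b !ge_min lexx !orbT.
- by rewrite linearZ /= [_ *: _]mulVf// gt_eqF.
- by move=> j jk gj; rewrite y1x// linearZ /= yx1// [_ *: _]mulr0.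
Qed.

(** The node [k] has the parent [par k] when [good k] holds, and is a root
    otherwise. At each node [z k] belongs to a prescribed set, and, up to a
    summable error, [y k] is the increment of [z] from the parent of [k]. *)
Lemma biorthogonal_forest e c (par : nat -> nat) (good : pred nat)
    (K : nat -> set (dual X)) : 0 < c -> 2 * c < e ->
  (forall k, good k -> (par k < k)%N /\ K (par k) `<=` szlenk_deriv e (K k)) ->
  (forall k, ~~ good k -> K k !=set0) ->
  exists (z y : nat -> dual X) (x : nat -> X),
    [/\ forall k, K k (z k),
      forall k, good k -> `|x k| <= 16 / c,
      forall k, good k -> `|y k - (z k - z (par k))| <= 2^-1 ^+ k &
      forall i j, good i -> good j -> y i (x j) = (i == j)%:R].
Proof.
move=> c0 ce parP K0.
pose S := (dual X * dual X * X)%type.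
pose Q k (h : nat -> S) (p : S) := K k p.1.1 /\ (good k ->
  [/\ `|p.2| <= 16 / c, `|p.1.2 - (p.1.1 - (h (par k)).1.1)| <= 2^-1 ^+ k,
    p.1.2 p.2 = 1 &
    forall j, (j < k)%N -> good j -> p.1.2 (h j).2 = 0 /\ (h j).1.2 p.2 = 0]).
have [h hQ] : exists h, forall k, Q k h (h k).
  apply: (strong_choice (0, 0, 0)).
    move=> k h h' p E [Kp H]; split=> // gk; have [h1 h2 h3 h4] := H gk.
    have [pk _] := parP k gk.
    split=> //; first by rewrite -E.
    by move=> j jk gj; rewrite -E//; exact: h4.
  move=> k h IH; have [gk|gk] := boolP (good k); last first.
    by have [z Kz] := K0 k gk; exists (z, 0, 0); split; rewrite // (negbTE gk).
  have [pk Kpar] := parP k gk.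
  have [Kp _] := IH _ pk.
  have d0 : 0 < 2^-1 ^+ k :> R by rewrite exprn_gt0.
  have := @biorthogonal_extend e c _ (K k) _ k good (fun j => (h j).2)
    (fun j => (h j).1.2) c0 ce d0 (Kpar _ Kp).
  case.
    move=> i j ik jk gi gj; have [_ /(_ gi)[_ _ hii hi]] := IH _ ik.
    have [_ /(_ gj)[_ _ _ hj]] := IH _ jk.
    have [ij|ji|<-] := ltngtP i j; last exact: hii.
    - by have [] := hj i ij gi.
    - by have [] := hi j ji gj.
  by move=> z' [y' [x' [? ? ? ? ?]]]; exists (z', y', x').
exists (fun k => (h k).1.1), (fun k => (h k).1.2), (fun k => (h k).2); split.
- by move=> k; have [] := hQ k.
- by move=> k gk; have [_ /(_ gk)[]] := hQ k.
- by move=> k gk; have [_ /(_ gk)[]] := hQ k.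
- move=> i j gi gj; have [_ /(_ gi)[_ _ hii hi]] := hQ i.
  have [_ /(_ gj)[_ _ _ hj]] := hQ j.
  have [ij|ji|<-] := ltngtP i j; last exact: hii.
  + by have [] := hj i ij gi.
  + by have [] := hi j ji gj.
Qed.

End BiorthogonalForest.

(** * Biorthogonal trees of unbounded heights *)

Section TreeCoding.
Variable T : countType.
Implicit Types (s t w : seq T) (n : nat).

(** The number of the node [t] of the [n]-th tree. The sequence is reversed,
    so that the parent of a node is obtained by removing the head of its code,
    and has a smaller number. *)
Definition node n t : nat := CodeSeq.code (rev (n :: map pickle t)).

Lemma node_inj n m s t : (node n s == node m t) = (n == m) && (s == t).
Proof.
rewrite /node (can_eq CodeSeq.codeK) (can_eq revK) eqseq_cons.
by rewrite (inj_eq (inj_map (pcan_inj pickleK))).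
Qed.

Lemma code_cons a (l : seq nat) :
  (CodeSeq.code l < CodeSeq.code (a :: l))%N.
Proof.
rewrite /= -[leqLHS]mul1n leq_mul ?expn_gt0//.
by rewrite ltnS -addnn leq_addr.
Qed.

Lemma size_le_code (l : seq nat) : (size l <= CodeSeq.code l)%N.
Proof. by elim: l => //= a l IH; apply: leq_ltn_trans IH (code_cons a l). Qed.

Lemma size_lt_node n t : (size t < node n t)%N.
Proof.
by apply: leq_trans (size_le_code _); rewrite size_rev /= size_map.
Qed.

Lemma node_rcons n t a : node n (rcons t a) =
  CodeSeq.code (pickle a :: rev (n :: map pickle t)).
Proof. by rewrite /node map_rcons -rcons_cons rev_rcons. Qed.

Lemma prefix_rconsE w t a :
  prefix w (rcons t a) = prefix w t || (w == rcons t a).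
Proof.
apply/idP/orP => [|[wt|/eqP->]]; last exact: prefix_refl.
  move=> wta; have := size_prefix wta; rewrite size_rcons leq_eqVlt => /orP[|].
    move=> /eqP sw; right; move: wta; rewrite prefixE sw.
    by rewrite take_oversize ?size_rcons// eq_sym.
  rewrite ltnS => sw; left; move: wta.
  by rewrite !prefixE -cats1 takel_cat.
by rewrite (prefix_trans wt)// prefix_rcons.
Qed.

End TreeCoding.

Section SzlenkTree.
Variables (R : realType) (X : normedModType R) (T : countType).
Implicit Types (s t : seq T) (n : nat).

(** The [n]-th tree has height [2 ^ n.+1]. *)
Lemma Sz_tree_system : xord_lt (Some omega) (Sz X) ->
  exists (x : nat -> seq T -> X) (Z : nat -> seq T -> dual X),
    [/\ forall n t, (0 < size t <= 2 ^ n.+1)%N -> `|x n t| <= 80,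
      forall n t, (size t <= 2 ^ n.+1)%N -> `|Z n t| <= 3 &
      forall n t m t', (size t <= 2 ^ n.+1)%N -> (0 < size t' <= 2 ^ m.+1)%N ->
        Z n t (x m t') = ((n == m) && prefix t' t)%:R].
Proof.
move=> HSz.
have Hne : forall n, iter n (szlenk_deriv 2^-1) (@dual_ball R X) !=set0.
  apply: Sz_gt_omega_iter => //.
  by rewrite invf_lt1// ltr1n.
(* a list [l] coding a node of the [n]-th tree ends with [n], and [node n nil]
   is the root of that tree; the node at depth [i] is sought in the set [K],
   which is the ball derived as many times as the levels that remain below it *)
pose N n := (2 ^ n.+1)%N.
pose good k := let l := CodeSeq.decode k in
  (1 < size l)%N && ((size l).-1 <= N (last 0%N l))%N.
pose par k := CodeSeq.code (behead (CodeSeq.decode k)).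
pose K k := let l := CodeSeq.decode k in
  iter (N (last 0%N l) - (size l).-1) (szlenk_deriv 2^-1) (@dual_ball R X).
have parP k : good k ->
    (par k < k)%N /\ K (par k) `<=` szlenk_deriv 2^-1 (K k).
  rewrite /good /par /K CodeSeq.codeK; have := CodeSeq.decodeK k.
  case: (CodeSeq.decode k) => [//|a [//|b l]] kE /andP[_ /= sl].
  split; first by rewrite -kE; exact: code_cons.
  by rewrite -iterS subnS prednK// subn_gt0.
have [z [y [x [zK xA yz biorth]]]] :=
  @biorthogonal_forest R X 2^-1 5^-1 par good K
  ltac:(by []) ltac:(lra) parP (fun k _ => Hne _).
have goodE n t : good (node n t) = (0 < size t <= N n)%N.
  rewrite /good /node CodeSeq.codeK size_rev /= size_map ltnS.
  by rewrite rev_cons last_rcons.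
have parE n t a : par (node n (rcons t a)) = node n t.
  by rewrite node_rcons /par CodeSeq.codeK.
have zB k : `|z k| <= 1 by have /iter_szlenk_deriv_sub := zK k.
pose Z n t : dual X := \sum_(i < size t) y (node n (take i.+1 t)).
have ZS n t a : Z n (rcons t a) = Z n t + y (node n (rcons t a)).
  rewrite /Z size_rcons big_ord_recr /= take_oversize ?size_rcons//.
  by congr (_ + _); apply: eq_bigr => i _; rewrite -cats1 takel_cat.
exists (fun n t => x (node n t)), Z; split.
- move=> n t tN; apply: (le_trans (xA _ _)); first by rewrite goodE.
  by rewrite invrK; lra.
- move=> n t tN.
  (* the errors along a branch are at most [2^-1 ^+ i], [i >= 1] *)
  suff H : `|Z n t - (z (node n t) - z (node n ([::] : seq T)))| <= 1 - 2^-1 ^+ size t.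
    set D := z _ - z _ in H.
    have DB : `|D| <= 2.
      by rewrite (le_trans (ler_normB _ _))// -[2]/(1 + 1) lerD.
    have -> : Z n t = (Z n t - D) + D by rewrite subrK.
    have := ler_normD (Z n t - D) D.
    have : 0 <= 2^-1 ^+ size t :> R by rewrite exprn_ge0.
    by lra.
  elim/last_ind: t tN => [|t a IH] tN.
    by rewrite /Z big_ord0 subrr subr0 normr0 subrr.
  rewrite size_rcons in tN *.
  rewrite ZS.
  have gk : good (node n (rcons t a)) by rewrite goodE size_rcons.
  have := yz _ gk; rewrite parE => yza.
  have -> : Z n t + y (node n (rcons t a)) -
      (z (node n (rcons t a)) - z (node n ([::] : seq T))) =
      (Z n t - (z (node n t) - z (node n ([::] : seq T)))) +
      (y (node n (rcons t a)) - (z (node n (rcons t a)) - z (node n t))).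
    by rewrite [RHS]addrACA -opprD [X in _ = _ - X]addrC addrA subrK.
  apply: (le_trans (ler_normD _ _)).
  apply: (le_trans (lerD (IH (ltnW tN)) yza)).
  have : 2^-1 ^+ node n (rcons t a) <= 2^-1 ^+ (size t).+1 :> R.
    rewrite ler_wiXn2l ?invr_ge0 ?invf_le1 ?ler1n//.
    by apply: ltnW; rewrite -(size_rcons t a) size_lt_node.
  by rewrite exprS; lra.
- move=> n t m t' + t'N; elim/last_ind: t => [|t a IH] tN.
    rewrite /Z big_ord0 prefixs0 (_ : (t' == [::]) = false) ?andbF//.
    by case: t' t'N.
  rewrite ZS dual_funD IH; last by rewrite size_rcons in tN; exact: ltnW.
  rewrite biorth; last 2 first.
  + by move: tN; rewrite goodE size_rcons.
  + by rewrite goodE.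
  rewrite node_inj prefix_rconsE (eq_sym t').
  have [_|_] /= := eqVneq n m; last by rewrite addr0.
  have [<-|_] /= := eqVneq (rcons t a) t'; last by rewrite addr0 orbF.
  rewrite orbT (_ : prefix _ _ = false) ?add0r//.
  by apply/negP => /size_prefix; rewrite size_rcons ltnn.
Qed.

End SzlenkTree.

(** * Gluing the trees *)

Section Gluing.
Variables (R : realType) (V : normedModType R) (T : eqType).
Variable v : nat -> seq T -> V.
Implicit Types (s t w : seq T) (n : nat).

(** The sum of the [v n t'] over the nonempty initial segments [t'] of [t]. *)
Definition branch n t : V := \sum_(i < size t) v n (take i.+1 t).

(** The affine function of [k] that is [0] at [2 ^ n] and [1] at [2 ^ n.+1]. *)
Definition weight n k : R := k%:R / (2 ^ n)%:R - 1.

(** In the shell [2 ^ n <= size t <= 2 ^ n.+1], the interpolation between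
    [branch n t] and [branch n.+1 t]; for the empty sequence, [0]. *)
Definition shell_sum t : V :=
  let n := trunc_log 2 (size t) in
  (1 - weight n (size t)) *: branch n t + weight n (size t) *: branch n.+1 t.

Lemma convex_step (a b : R) (p q f g : V) :
  (1 - (a + b)) *: (p + f) + (a + b) *: (q + g) - ((1 - a) *: p + a *: q) =
  ((1 - (a + b)) *: f + (a + b) *: g) + b *: (q - p).
Proof.
rewrite [in LHS]scalerDr [(a + b) *: (_ + _)]scalerDr addrACA.
rewrite [LHS]addrAC [LHS]addrC; congr (_ + _).
rewrite [- (_ *: _ + _)]opprD addrACA -!scalerBl.
have -> : 1 - (a + b) - (1 - a) = - b by ring.
have -> : a + b - a = b by ring.
by rewrite scaleNr addrC -scalerBr.
Qed.

Lemma branch_nil n : branch n [::] = 0.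
Proof. by rewrite /branch big_ord0. Qed.

Lemma branch_rcons n t a : branch n (rcons t a) = branch n t + v n (rcons t a).
Proof.
rewrite /branch size_rcons big_ord_recr /= take_oversize ?size_rcons//.
by congr (_ + _); apply: eq_bigr => i _; rewrite -cats1 takel_cat.
Qed.

Lemma shell_sum_nil : shell_sum [::] = 0.
Proof. by rewrite /shell_sum !branch_nil !scaler0 addr0. Qed.

(** At the outer end [size t = 2 ^ n.+1] of the shell, both this formula and
    the one for the next shell give [branch n.+1 t]. *)
Lemma shell_sumE n t : (2 ^ n <= size t <= 2 ^ n.+1)%N ->
  shell_sum t = (1 - weight n (size t)) *: branch n t +
           weight n (size t) *: branch n.+1 t.
Proof.
have p0 m : (2 ^ m)%:R != 0 :> R by rewrite pnatr_eq0 -lt0n expn_gt0.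
case/andP=> n1; rewrite leq_eqVlt => /predU1P[n2|n2]; last first.
  by rewrite /shell_sum (@trunc_log_eq 2 n)// n1.
rewrite /shell_sum n2 trunc_expnK// /weight divff// subrr subr0 scale1r scale0r addr0.
rewrite expnS natrM mulfK//.
by rewrite -[2%:R]/(1 + 1) addrK subrr scale0r scale1r add0r.
Qed.

Lemma weight_itv n k : (2 ^ n <= k <= 2 ^ n.+1)%N -> 0 <= weight n k <= 1.
Proof.
have p0 : 0 < (2 ^ n)%:R :> R by rewrite ltr0n expn_gt0.
case/andP=> n1 n2; rewrite /weight subr_ge0 lerBlDr ler_pdivlMr// mul1r.
by rewrite ler_nat n1 ler_pdivrMr// -[1 + 1]/(2%:R) -natrM ler_nat -expnS.
Qed.

(** The vectors indexed by the nonempty nodes of each tree have norm at most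
    [A]. The other values of [v] are irrelevant. *)
Definition nodes_bounded (A : R) : Prop :=
  forall n t, (0 < size t <= 2 ^ n.+1)%N -> `|v n t| <= A.

(** Functionals of norm at most [B] detect the branches: for [w] an
    ancestor of [s] in the [m]-th tree, one of them is [1] on the nodes between
    [w] and [s], and vanishes on the other trees and on the nodes that do not
    extend [w]. Nothing is required at the other extensions of [w]. *)
Definition branches_detected (B : R) : Prop :=
  forall m s w, prefix w s -> (0 < size w)%N -> (size s <= 2 ^ m.+1)%N ->
  exists L : {linear V -> R^o},
    [/\ forall a, `|L a| <= B * `|a|,
      forall p t, (0 < size t <= 2 ^ p.+1)%N ->
        (p != m) || ~~ prefix w t -> L (v p t) = 0 &
      forall t, prefix w t -> prefix t s -> L (v m t) = 1].

Variables (A B : R).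
Hypothesis vA : nodes_bounded A.

Lemma branch_le n t : (size t <= 2 ^ n.+1)%N -> `|branch n t| <= A * (size t)%:R.
Proof.
elim/last_ind: t => [|t a IH] tN; first by rewrite branch_nil normr0 mulr0.
rewrite branch_rcons (le_trans (ler_normD _ _))// size_rcons -natr1 mulrDr mulr1.
rewrite lerD//; first by apply: IH; rewrite size_rcons in tN; exact: ltnW.
by apply: vA; rewrite size_rcons in tN *.
Qed.

Lemma shell_sum_rcons t a : `|shell_sum (rcons t a) - shell_sum t| <= 5 * A.
Proof.
have A0 : 0 <= A by apply: le_trans (@vA 0 [:: a] _); rewrite ?normr_ge0.
have [t0|t0] := posnP (size t).
  rewrite (size0nil t0) shell_sum_nil subr0 (@shell_sumE 0)//= /weight expn0 divff//.
  rewrite subrr subr0 scale1r scale0r addr0 (branch_rcons 0 [::]) branch_nil add0r.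
  by apply: (le_trans (vA _)) => //; rewrite ler_peMl// ler1n.
have /andP[n1 n2] := @trunc_log_bounds 2 (size t) isT t0.
set n := trunc_log 2 (size t) in n1 n2.
rewrite (@shell_sumE n (rcons t a)) ?(@shell_sumE n t) ?n1 ?(ltnW n2)
  ?size_rcons//; last first.
  by rewrite n2 (leq_trans n1).
have p0 : 0 < (2 ^ n)%:R :> R by rewrite ltr0n expn_gt0.
have wS : weight n (size t).+1 = weight n (size t) + (2 ^ n)%:R^-1.
  by rewrite /weight -natr1 mulrDl mul1r addrAC.
have : 0 <= weight n (size t).+1 <= 1.
  by apply: weight_itv; rewrite n2 (leq_trans n1).
rewrite wS !branch_rcons.
set w := weight _ _; set b := _^-1; set p := branch n t; set q := branch n.+1 t.
set f := v n _; set g := v _ _ => /andP[w0 w1].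
rewrite convex_step.
have b0 : 0 < b by rewrite invr_gt0.
have fA : `|f| <= A by apply: vA; rewrite size_rcons.
have gA : `|g| <= A.
  by apply: vA; rewrite size_rcons /= expnS (leq_trans n2)// leq_pmull.
have pA : `|p| <= A * (size t)%:R by apply: branch_le; exact: ltnW.
have qA : `|q| <= A * (size t)%:R.
  by apply: branch_le; rewrite expnS (leq_trans (ltnW n2))// leq_pmull.
have bt : b * (size t)%:R <= 2.
  rewrite /b mulrC ler_pdivrMr// -natrM ler_nat -expnS; exact: ltnW.
apply: (le_trans (ler_normD _ _)).
apply: (@le_trans _ _ (A + b * (A * (size t)%:R + A * (size t)%:R))).
  apply: lerD; last first.
    rewrite normrZ gtr0_norm// ler_wpM2l ?(ltW b0)//.
    by rewrite (le_trans (ler_normB _ _))// lerD.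
  apply: (le_trans (ler_normD _ _)); rewrite !normrZ !ger0_norm ?subr_ge0//.
  apply: (@le_trans _ _ ((1 - (w + b)) * A + (w + b) * A)).
    by rewrite lerD// ler_wpM2l// subr_ge0.
  by rewrite -mulrDl subrK mul1r.
have : A * (b * (size t)%:R) <= A * 2 by rewrite ler_wpM2l.
rewrite mulrCA; lra.
Qed.

Lemma shell_sum_cat t r : `|shell_sum (t ++ r) - shell_sum t| <= 5 * A * (size r)%:R.
Proof.
elim/last_ind: r => [|r a IH]; first by rewrite cats0 subrr normr0 mulr0.
rewrite -rcons_cat -(subrK (shell_sum (t ++ r)) (shell_sum (rcons _ _))) -addrA.
rewrite (le_trans (ler_normD _ _))// size_rcons -[(size r).+1%:R]natr1.
by rewrite mulrDr mulr1 [leRHS]addrC lerD// shell_sum_rcons.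
Qed.

Lemma shell_sum_prefix u t :
  prefix u t -> `|shell_sum t - shell_sum u| <= 5 * A * ((size t)%:R - (size u)%:R).
Proof.
case/prefixP=> r ->.
have -> : (size (u ++ r))%:R - (size u)%:R = (size r)%:R :> R.
  by rewrite size_cat natrD addrAC subrr add0r.
exact: shell_sum_cat.
Qed.

Hypothesis vB : branches_detected B.

Lemma sum_leq_succ k m :
  (0 < m)%N -> (\sum_(i < k) (m <= i.+1) = k.+1 - m)%N.
Proof.
move=> m0; elim: k => [|k IH]; first by rewrite big_ord0; case: m m0 => [|[]].
rewrite big_ord_recr /= IH; have [mk|km] := leqP m k.+1.
  by rewrite addn1 -subSn.
by rewrite addn0 (eqP (ltnW km : k.+1 - m == 0)%N) (eqP (km : k.+2 - m == 0)%N).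
Qed.

(** The functional used is the sum of those that detect [s] in the two trees
    combined at [s]. *)
Lemma shell_sum_separated s s' w : prefix w s -> (0 < size w)%N -> ~~ prefix w s' ->
  (size s).+1%:R - (size w)%:R <= 2 * B * `|shell_sum s - shell_sum s'|.
Proof.
move=> ws w0 ws'.
have s0 : (0 < size s)%N := leq_trans w0 (size_prefix ws).
have sle : (size s < 2 ^ (trunc_log 2 (size s)).+1)%N by exact: trunc_log_ltn.
have shell_sumD t : exists n, [/\ (size t <= 2 ^ n.+1)%N & shell_sum t =
  (1 - weight n (size t)) *: branch n t + weight n (size t) *: branch n.+1 t].
  exists (trunc_log 2 (size t)); split=> //.
  by apply: ltnW; exact: trunc_log_ltn.
set n := trunc_log 2 (size s) in sle.
have le2 m k : (k <= 2 ^ m.+1)%N -> (k <= 2 ^ m.+2)%N.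
  by move=> /leq_trans; apply; rewrite leq_exp2l.
have [L1 [L1B L10 L11]] := vB ws w0 (ltnW sle).
have [L2 [L2B L20 L21]] := vB ws w0 (le2 _ _ (ltnW sle)).
have pref t i : (i < size t)%N -> (0 < size (take i.+1 t))%N.
  by move=> it; rewrite size_takel.
have prefle t i M : (size t <= M)%N -> (size (take i.+1 t) <= M)%N.
  by apply: leq_trans; rewrite size_take_min geq_minr.
(* both functionals vanish on the branches towards [s'] *)
have Ls' (L : {linear V -> R^o}) m :
    (forall p t, (0 < size t <= 2 ^ p.+1)%N ->
      (p != m) || ~~ prefix w t -> L (v p t) = 0) ->
    L (shell_sum s') = 0.
  move=> L0; have [k [sk ->]] := shell_sumD s'.
  have b0 p : (size s' <= 2 ^ p.+1)%N -> L (branch p s') = 0.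
    move=> sp; rewrite /branch linear_sum big1// => i _.
    apply: L0; first by rewrite pref// prefle.
    apply/orP; right; apply: contra ws' => /prefix_trans; apply.
    exact: prefix_take.
  by rewrite linearD !linearZ /= !b0 ?le2// !scaler0 addr0.
have count (L : {linear V -> R^o}) m :
    (forall p t, (0 < size t <= 2 ^ p.+1)%N ->
      (p != m) || ~~ prefix w t -> L (v p t) = 0) ->
    (forall t, prefix w t -> prefix t s -> L (v m t) = 1) ->
    (size s <= 2 ^ m.+1)%N ->
    L (branch m s) = (size s).+1%:R - (size w)%:R.
  move=> L0 Ls sm; rewrite -natrB; last by rewrite leqW ?size_prefix.
  rewrite -sum_leq_succ// natr_sum /branch linear_sum; apply: eq_bigr => i _.
  have wt : prefix w (take i.+1 s) = (size w <= i.+1)%N.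
    apply/idP/idP => [/size_prefix|wi]; first by rewrite size_takel.
    by rewrite prefixE take_takel// -prefixE.
  rewrite -wt; have [ww|ww] := boolP (prefix w _); last first.
    by rewrite L0 ?ww ?orbT// pref// prefle.
  by rewrite Ls// prefix_take.
have zero (L : {linear V -> R^o}) m p :
    (forall p t, (0 < size t <= 2 ^ p.+1)%N ->
      (p != m) || ~~ prefix w t -> L (v p t) = 0) ->
    p != m -> (size s <= 2 ^ p.+1)%N -> L (branch p s) = 0.
  move=> L0 pm sp; rewrite /branch linear_sum big1// => i _.
  by apply: L0; rewrite ?pm// pref// prefle.
have nn : n.+1 != n by rewrite gtn_eqF.
have nn' : n != n.+1 by rewrite ltn_eqF.
have Ls : L1 (shell_sum s) + L2 (shell_sum s) = (size s).+1%:R - (size w)%:R.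
  rewrite /shell_sum -/n; move: (weight n _) => a.
  rewrite !linearD !linearZ /=.
  rewrite (count _ _ L10 L11 (ltnW sle)) (count _ _ L20 L21 (le2 _ _ (ltnW sle))).
  rewrite (zero _ _ _ L10 nn (le2 _ _ (ltnW sle))) (zero _ _ _ L20 nn' (ltnW sle)).
  by rewrite !scaler0 addr0 add0r -scalerDl subrK scale1r.
rewrite -Ls.
have -> : L1 (shell_sum s) + L2 (shell_sum s) =
  L1 (shell_sum s - shell_sum s') + L2 (shell_sum s - shell_sum s').
  by rewrite !linearB /= (Ls' _ _ L10) (Ls' _ _ L20) !subr0.
have := L1B (shell_sum s - shell_sum s').
have := L2B (shell_sum s - shell_sum s').
have := ler_norm (L1 (shell_sum s - shell_sum s')).
have := ler_norm (L2 (shell_sum s - shell_sum s')).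
by lra.
Qed.

End Gluing.

(** * Embedding the infinite tree *)

Section TreeEmbedding.
Variable R : realType.

Lemma embeds_of_bounds (M N : Type) (dM : M -> M -> R) (dN : N -> N -> R)
    (f : M -> N) (a b C : R) (p0 q0 : M) :
  p0 <> q0 -> (forall p q, p <> q -> 0 < dM p q /\ 0 < dN (f p) (f q)) ->
  (forall p, dN (f p) (f p) = 0) ->
  (forall p q, dN (f p) (f q) <= a * dM p q) ->
  (forall p q, dM p q <= b * dN (f p) (f q)) ->
  a * b <= C -> embeds dM dN C.
Proof.
move=> pq0 pos dN0 up lo abC; exists f.
  move=> p q fpq; apply: contrapT => /pos[_].
  by rewrite fpq dN0 ltxx.
rewrite /distortion (@le_trans _ _ (a%:E * b%:E)%E) ?lee_fin//.
have [dM0 dfN0] := pos _ _ pq0.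
apply: lee_pmul.
- apply: ereal_sup_ge; eexists; first by exists (p0, q0).
  by rewrite lee_fin /= divr_ge0// ltW.
- apply: ereal_sup_ge; eexists; first by exists (p0, q0).
  by rewrite lee_fin /= divr_ge0// ltW.
- apply: ge_ereal_sup => _ [[p q] /= /pos[p1 p2] <-].
  by rewrite lee_fin ler_pdivrMr.
- apply: ge_ereal_sup => _ [[p q] /= /pos[p1 p2] <-].
  by rewrite lee_fin ler_pdivrMr.
Qed.

Lemma common_ancestor_prefix (s t : tree) :
  prefix (common_ancestor s t) s /\ prefix (common_ancestor s t) t.
Proof.
by apply/andP; rewrite -common_ancestor_greatest prefix_refl.
Qed.

Lemma common_ancestorC (s t : tree) : common_ancestor s t = common_ancestor t s.
Proof.
elim: s t => [|x s IH] [|y t] //=; rewrite eq_sym.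
by case: eqVneq => // ->; rewrite IH.
Qed.

Variables (V : normedModType R) (v : nat -> tree -> V) (A B : R).
Hypothesis vA : nodes_bounded v A.
Hypothesis vB : branches_detected v B.
Hypothesis B0 : 0 <= B.

Lemma shell_sum_lower (s t : tree) :
  (size s)%:R - (size (common_ancestor s t))%:R <=
    2 * B * `|shell_sum v s - shell_sum v t| :> R.
Proof.
have [us ut] := common_ancestor_prefix s t.
set u := common_ancestor s t in us ut *.
have := size_prefix us; rewrite leq_eqVlt => /orP[/eqP->|lt].
  by rewrite subrr !mulr_ge0.
have wt : ~~ prefix (take (size u).+1 s) t.
  apply/negP => wt.
  have : prefix (take (size u).+1 s) u.
    by rewrite common_ancestor_greatest wt prefix_take.
  by move=> /size_prefix; rewrite size_takel// ltnn.
have := shell_sum_separated vB (prefix_take s (size u).+1) _ wt.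
rewrite size_takel// => /(_ isT); apply: le_trans.
by rewrite -[(size s).+1%:R]natr1 -[(size u).+1%:R]natr1 opprD addrACA subrr addr0.
Qed.

Lemma shell_sum_embeds C : 20 * A * B <= C ->
  embeds (@tree_dist R) (@norm_dist R V) C.
Proof.
move=> ABC.
have up (s t : tree) : norm_dist (shell_sum v s) (shell_sum v t) <= 5 * A * tree_dist R s t.
  have [us ut] := common_ancestor_prefix s t.
  have := shell_sum_prefix vA us; have := shell_sum_prefix vA ut.
  rewrite /norm_dist /tree_dist; set u := common_ancestor s t => h1 h2.
  rewrite -(subrK (shell_sum v u) (shell_sum v s)) -addrA (le_trans (ler_normD _ _))//.
  rewrite (distrC (shell_sum v u)); move: h1 h2; rewrite -[2]/(1 + 1).
  by rewrite mulrDl mul1r; lra.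
have lo (s t : tree) : tree_dist R s t <= 4 * B * norm_dist (shell_sum v s) (shell_sum v t).
  have := shell_sum_lower s t; have := shell_sum_lower t s.
  rewrite (common_ancestorC t) (distrC (shell_sum v t)) /tree_dist /norm_dist.
  by lra.
apply: (@embeds_of_bounds _ _ _ _ (shell_sum v) (5 * A) (4 * B) _ [::]
  [:: exist _ 1%N isT]) => //; last by lra.
- move=> s t st.
  have d0 : 0 < tree_dist R s t.
    have [us ut] := common_ancestor_prefix s t.
    rewrite /tree_dist ltNge; apply/negP => le0; apply: st.
    have su := size_prefix us; have tu := size_prefix ut.
    move: us ut; rewrite !prefixE !take_oversize; first by move=> /eqP <- /eqP.
      rewrite -(ler_nat R); move: su tu le0; rewrite -!(ler_nat R); lra.
    rewrite -(ler_nat R); move: su tu le0; rewrite -!(ler_nat R); lra.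
  split=> //; rewrite lt_neqAle normr_ge0 andbT eq_sym; apply/negP => /eqP n0.
  by have := lo s t; rewrite n0 mulr0 leNgt d0.
- by move=> s; rewrite /norm_dist subrr normr0.
Qed.

End TreeEmbedding.

Section DualEvaluation.
Variables (R : realType) (X : normedModType R) (x : X).

Definition dual_eval (f : dual X) : R^o := f x.

Lemma dual_eval_linear : linear dual_eval.
Proof. by []. Qed.

HB.instance Definition _ :=
  GRing.isLinear.Build R (dual X) R^o _ dual_eval dual_eval_linear.

End DualEvaluation.

Theorem theorem2p4 (R : realType) :
  exists C : R, 1 <= C /\
    forall X : completeNormedModType R,
      separable X ->
      xord_lt (Some omega) (Sz X) ->
      embeds (@tree_dist R) (@norm_dist R X) C /\
      embeds (@tree_dist R) (@norm_dist R (dual X)) C.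
Proof.
(* the constant is [20 * 80 * 6] for [X], and [20 * 3 * 80] suffices for the
   dual; [80] is [16 / c] for [c = 5^-1] *)
exists 9600; split; first by rewrite ler1n.
move=> X _ /(@Sz_tree_system R X {n : nat | (0 < n)%N})[x [Z [xA ZB Zx]]].
have prefix_size (s w : tree) (m : nat) :
    prefix w s -> (size s <= 2 ^ m)%N -> (size w <= 2 ^ m)%N.
  by move=> /size_prefix; exact: leq_trans.
split.
- apply: (@shell_sum_embeds R X x 80 6) => //; last by lra.
  move=> m s w ws w0 sm.
  (* [s'] is the parent of [w], and the difference of the two functionals is the
     sum of the increments from [w] to [s] *)
  pose s' := take (size w).-1 s.
  have s's : prefix s' s by exact: prefix_take.
  have s'm : (size s' <= 2 ^ m.+1)%N by exact: prefix_size s's sm.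
  exists (Z m s - Z m s' : {linear X -> R^o}).
  have s'sz : (size s' < size w)%N.
    by rewrite /s' (leq_ltn_trans _ (_ : (size w).-1 < _)%N) ?prednK// size_take_min geq_minl.
  split=> [a|p t tp|t wt ts].
  + rewrite (le_trans (dual_norm_le _ _))// ler_wpM2r//.
    by rewrite (le_trans (ler_normB _ _))// (le_trans (lerD (ZB _ _ sm) (ZB _ _ s'm)))//; lra.
  + move=> pmw.
    change (Z m s (x p t) - Z m s' (x p t) = 0).
    rewrite !Zx//; move: pmw; rewrite (eq_sym p); case: eqVneq => //= _ wt.
      suff -> : prefix t s = prefix t s' by rewrite subrr.
      apply/idP/idP => [ts|/prefix_trans]; last exact.
      move: (ts); rewrite prefixE => /eqP tE.
      have tw : (size t < size w)%N.
        rewrite ltnNge; apply: contra wt => wt.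
        by rewrite prefixE -tE take_takel// -prefixE.
      rewrite prefixE take_takel ?tE// -ltnS prednK//.
    by rewrite subrr.
  + change (Z m s (x m t) - Z m s' (x m t) = 1).
    have tm : (0 < size t <= 2 ^ m.+1)%N.
      by rewrite (leq_trans w0 (size_prefix wt)) (prefix_size _ _ _ ts).
    rewrite !Zx// eqxx ts (_ : prefix t s' = false) ?subr0//.
    apply/negP => /size_prefix; apply/negP; rewrite -ltnNge.
    exact: leq_trans s'sz (size_prefix wt).
- apply: (@shell_sum_embeds R (dual X) Z 3 80) => //; last by lra.
    by move=> n t /andP[_]; exact: ZB.
  move=> m s w ws w0 sm; exists (dual_eval (x m w) : {linear dual X -> R^o}).
  have wm : (0 < size w <= 2 ^ m.+1)%N by rewrite w0 (prefix_size _ _ _ ws).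
  split=> [f|p t /andP[_ tp] pmw|t wt ts].
  + by rewrite (le_trans (dual_norm_le _ _))// mulrC ler_wpM2r// xA.
  + by rewrite /= /dual_eval Zx//; case: eqP pmw => //= _ /negbTE ->.
  + by rewrite /= /dual_eval Zx ?eqxx ?wt// (prefix_size _ _ _ ts).
Qed.
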